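(* Let $T$ be a homogeneous tree of degree $q\ge 2$. The horospherical fiber bundles $\mathcal H_V$ and $\mathcal H_E$ are isomorphic, via the canonical correspondence $\Xi:\mathcal H_V\to\mathcal H_E$, which commutes with the action of $\operatorname{Aut}T$. However, $\Xi$ does not map special sections to special sections; more generally, there is no fiber bundle isomorphism $\alpha:\mathcal H_V\to\mathcal H_E$ that maps a pair of distinct special sections $\Sigma_{v_0},\Sigma_{v}$ ($v_0\neq v$ in $V$) of $\mathcal H_V$ to a pair of special sections $\Sigma_{e_0},\Sigma_e$ of $\mathcal H_E$. On the other hand, for every special section $\Sigma_v$ of $\mathcal H_V$ ($v\in V$) and every special section $\Sigma_e$ of $\mathcal H_E$ ($e\in E$) there is a fiber bundle isomorphism from $\mathcal H_V$ to $\mathcal H_E$ that maps $\Sigma_v$ onto $\Sigma_e$ (and, vice versa, one from $\mathcal H_E$ to $\mathcal H_V$ that maps $\Sigma_e$ onto $\Sigma_v$).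
   Context: $T$ is a tree in which every vertex has exactly $q+1$ neighbours; $V$, $E$ are its sets of vertices and (unoriented) edges, $\operatorname{dist}$ the graph distance on $V$, $\operatorname{Aut}T$ its automorphism group. $\Omega$ is the set of ends: equivalence classes of geodesic rays, two rays being equivalent if they eventually coincide; $[v,\omega)$ is the unique ray starting at $v$ in the class $\omega$. The topology of $\Omega$ is generated by the arcs $\Omega(u,v)=\{\omega: v\in[u,\omega)\}$, $u\ne v$. Vertex-horospherical index: $h(v,v_0,\omega)=\operatorname{dist}(v_0,w)-\operatorname{dist}(v,w)$ for any $w$ far enough along $[v_0,\omega)$. Edge-horospherical index: $h(e,e_0,\omega)=h(v(e,\omega),v(e_0,\omega),\omega)$, where $v(e,\omega)$ is the endpoint of $e$ closer to $\omega$. A vertex-horosphere (edge-horosphere) tangent at $\omega$ is a level set of $v\mapsto h(v,v_0,\omega)$ (of $e\mapsto h(e,e_0,\omega)$); this does not depend on $v_0$ (on $e_0$). $\mathcal H_V$ (resp. $\mathcal H_E$) is the set of all vertex- (resp. edge-) horospheres, each with its tangency point. It is a trivial principal bundle with base $\Omega$ (projection: tangency point) and structure group $\mathbb Z$: a choice of $v_0$ (resp. $e_0$) gives a global chart $\mathcal H\cong\Omega\times\mathbb Z$, $\mathbf h\mapsto(\omega,n)$ with $n$ the index; the topology is the product topology and $k\in\mathbb Z$ acts by $(\omega,n)\mapsto(\omega,n+k)$. A bundle isomorphism is a homeomorphism that commutes with the $\mathbb Z$-actions and covers a homeomorphism of the bases. The special section $\Sigma_v\subset\mathcal H_V$ is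 the set of all vertex-horospheres that contain $v$ (one for each $\omega$); $\Sigma_e\subset\mathcal H_E$ is the set of all edge-horospheres that contain $e$. The canonical correspondence $\Xi$ maps the vertex-horosphere $\mathbf h$ tangent at $\omega$ to the edge-horosphere $\{[v,v_+]:v\in\mathbf h\}$ tangent at $\omega$, where $v_+$ is the neighbour of $v$ closer to $\omega$. *)

(* Defs.v *)
From HB Require Import structures.
From mathcomp Require Import all_boot all_order all_algebra.
From mathcomp Require Import mathcomp_extra boolp classical_sets functions.
From mathcomp Require Import cardinality filter topology.

Set Implicit Arguments.
Unset Strict Implicit.
Unset Printing Implicit Defensive.

Import Order.TTheory GRing.Theory Num.Theory.
Local Open Scope classical_set_scope.

(** * Homogeneous trees *)

Record tree := Tree {
  vertex :> choiceType;
  adj : rel vertex;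
  adj_sym : symmetric adj;
  adj_irr : irreflexive adj;
  tree_nonempty : exists v : vertex, True;
  tree_connected : forall u v : vertex,
    exists2 p : seq vertex, path adj u p & last u p = v;
  tree_acyclic : forall c : seq vertex, (2 < size c)%N -> ~ ucycle adj c }.

Arguments adj {t} _ _.

Definition homogeneous (T : tree) (q : nat) : Prop :=
  forall v : T, ([set u | adj v u] #= `I_q.+1)%card.

Record edge (T : tree) := Edge {
  endpoints : set T;
  endpointsP : exists u v : T, adj u v /\ endpoints = [set u; v] }.

Definition walk (T : tree) (u v : T) (n : nat) : Prop :=
  exists p : seq T, [/\ path adj u p, last u p = v & size p = n].

Definition dist (T : tree) (u v : T) : nat :=
  xget 0%N [set n | walk u v n /\ forall m, walk u v m -> (n <= m)%N].

Record automorphism (T : tree) := Automorphism {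
  aut_fun :> T -> T;
  aut_bij : bijective aut_fun;
  aut_adj : {mono aut_fun : u v / adj u v} }.

(** * Ends *)

Definition geodesic_ray (T : tree) (r : nat -> T) : Prop :=
  forall i j, (i <= j)%N -> dist (r i) (r j) = (j - i)%N.

(* The rays eventually coincide as vertex sets: they are parametrized from
   their own starting points, so the indices may differ by a shift. *)
Definition cofinal (T : tree) (r s : nat -> T) : Prop :=
  exists m n, forall i, r (m + i)%N = s (n + i)%N.

Record tree_end (T : tree) := TreeEnd {
  rays : set (nat -> T);
  raysP : exists2 r, geodesic_ray r &
            rays = [set s | geodesic_ray s /\ cofinal r s] }.

HB.instance Definition _ (T : tree) := gen_eqMixin (tree_end T).
HB.instance Definition _ (T : tree) := gen_choiceMixin (tree_end T).

(* [ray_from v w r]: r is the ray [v, w). *)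
Definition ray_from (T : tree) (v : T) (w : tree_end T) (r : nat -> T) : Prop :=
  rays w r /\ r 0%N = v.

Definition arc (T : tree) (u v : T) : set (tree_end T) :=
  [set w | exists2 r, ray_from u w r & exists i, r i = v].

HB.instance Definition _ (T : tree) := isSubBaseTopological.Build (tree_end T)
  [set A | exists u v : T, u <> v /\ A = arc u v] id.

(** * Horospheres *)

Definition vindex (T : tree) (v v0 : T) (w : tree_end T) : int :=
  xget 0%R [set n : int | exists2 r, ray_from v0 w r &
    \forall i \near \oo, n = ((dist v0 (r i))%:Z - (dist v (r i))%:Z)%R].

Definition closer (T : tree) (w : tree_end T) (u v : T) : Prop :=
  exists2 r, rays w r & \forall i \near \oo, (dist u (r i) < dist v (r i))%N.

(* [near_endpoint e w u]: u is the endpoint v(e, w) of e. *)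
Definition near_endpoint (T : tree) (e : edge T) (w : tree_end T) (u : T) :
    Prop :=
  endpoints e u /\ exists2 v, endpoints e v & closer w u v.

Definition eindex (T : tree) (e e0 : edge T) (w : tree_end T) : int :=
  xget 0%R [set n : int | exists u u0,
    [/\ near_endpoint e w u, near_endpoint e0 w u0 & n = vindex u u0 w]].

Definition vlevel (T : tree) (v0 : T) (w : tree_end T) (n : int) : set T :=
  [set v | vindex v v0 w = n].

Definition elevel (T : tree) (e0 : edge T) (w : tree_end T) (n : int) :
    set (edge T) :=
  [set e | eindex e e0 w = n].

Record vhorosphere (T : tree) := VHorosphere {
  vtangency : tree_end T;
  vcarrier : set T;
  vcarrierP : exists v0 n, vcarrier = vlevel v0 vtangency n }.

Record ehorosphere (T : tree) := EHorosphere {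
  etangency : tree_end T;
  ecarrier : set (edge T);
  ecarrierP : exists e0 n, ecarrier = elevel e0 etangency n }.

HB.instance Definition _ (T : tree) := gen_eqMixin (vhorosphere T).
HB.instance Definition _ (T : tree) := gen_choiceMixin (vhorosphere T).
HB.instance Definition _ (T : tree) := gen_eqMixin (ehorosphere T).
HB.instance Definition _ (T : tree) := gen_choiceMixin (ehorosphere T).

Definition vsection (T : tree) (v : T) : set (vhorosphere T) :=
  [set h | vcarrier h v].

Definition esection (T : tree) (e : edge T) : set (ehorosphere T) :=
  [set h | ecarrier h e].

(** * The horospherical bundles *)

Record zbundle := ZBundle {
  base : topologicalType;
  total : topologicalType;
  proj : total -> base;
  zact : int -> total -> total }.

Definition homeomorphism (X Y : topologicalType) (f : X -> Y) : Prop :=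
  continuous f /\
  exists g : Y -> X, [/\ cancel f g, cancel g f & continuous g].

Definition bundle_iso (B C : zbundle) (f : total B -> total C) : Prop :=
  [/\ homeomorphism f,
      forall k x, f (zact k x) = zact k (f x) &
      exists2 phi : base B -> base C, homeomorphism phi &
        forall x, proj (f x) = phi (proj x)].
Arguments bundle_iso : clear implicits.

Definition vchart (T : tree) (v0 : T) (h : vhorosphere T) :
    tree_end T * discrete_topology int :=
  (vtangency h, xget 0%R [set n | vcarrier h = vlevel v0 (vtangency h) n]).

Definition echart (T : tree) (e0 : edge T) (h : ehorosphere T) :
    tree_end T * discrete_topology int :=
  (etangency h, xget 0%R [set n | ecarrier h = elevel e0 (etangency h) n]).

(* The horosphere with coordinates (w, n) in the chart of v0 (resp. e0). *)
Definition vhoro_at (T : tree) (v0 : T) (w : tree_end T) (n : int) :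
    vhorosphere T :=
  VHorosphere (ex_intro _ v0 (ex_intro _ n (erefl (vlevel v0 w n)))).

Definition ehoro_at (T : tree) (e0 : edge T) (w : tree_end T) (n : int) :
    ehorosphere T :=
  EHorosphere (ex_intro _ e0 (ex_intro _ n (erefl (elevel e0 w n)))).

(* The chart is a bijection onto the product, so its initial topology is the
   product topology carried back to the set of horospheres. *)
Definition vbundle (T : tree) (v0 : T) : zbundle :=
  @ZBundle (tree_end T) (initial_topology (vchart v0)) (@vtangency T)
    (fun k h => vhoro_at v0 (vchart v0 h).1 ((vchart v0 h).2 + k : int)%R).

Definition ebundle (T : tree) (e0 : edge T) : zbundle :=
  @ZBundle (tree_end T) (initial_topology (echart e0)) (@etangency T)
    (fun k h => ehoro_at e0 (echart e0 h).1 ((echart e0 h).2 + k : int)%R).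

(** * The canonical correspondence *)

(* These conditions determine Xi, a horosphere being given by its tangency
   point and its set of vertices or edges. *)
Definition canonical_correspondence (T : tree)
    (Xi : vhorosphere T -> ehorosphere T) : Prop :=
  forall h, etangency (Xi h) = vtangency h /\
    ecarrier (Xi h) =
      [set e | exists v v_plus, [/\ vcarrier h v, adj v v_plus,
        closer (vtangency h) v_plus v & endpoints e = [set v; v_plus]]].

(** * The action of the automorphism group *)

Section AutAction.
Variables (T : tree) (g : automorphism T).

Lemma aut_inj : injective g.
Proof. exact: bij_inj (aut_bij g). Qed.

Lemma aut_walk u v n : walk (g u) (g v) n <-> walk u v n.
Proof.
have [k gk kg] := aut_bij g; split=> -[p [pp lp sp]].
- exists (map k p); split; last by rewrite size_map.
  + have -> : u = k (g u) by rewrite gk.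
    rewrite path_map; apply: sub_path pp => x y /= xy.
    by rewrite -(aut_adj g) /= !kg.
  + by rewrite -[u in LHS]gk last_map lp gk.
- exists (map g p); split; last by rewrite size_map.
  + by rewrite path_map; apply: sub_path pp => x y /=; rewrite aut_adj.
  + by rewrite last_map lp.
Qed.

Lemma aut_dist u v : dist (g u) (g v) = dist u v.
Proof.
rewrite /dist; congr (xget 0%N _); apply/seteqP; split=> n /= [wn mn].
- by split=> [|m /aut_walk]; [exact/aut_walk | exact: mn].
- by split=> [|m /aut_walk]; [exact/aut_walk | exact: mn].
Qed.

Lemma aut_geodesic r : geodesic_ray (g \o r) <-> geodesic_ray r.
Proof. by split=> gr i j ij; have := gr i j ij; rewrite /= aut_dist. Qed.

Lemma aut_raysP (w : tree_end T) :
  exists2 r, geodesic_ray r &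
    (fun r => g \o r) @` rays w = [set s | geodesic_ray s /\ cofinal r s].
Proof.
have [k gk kg] := aut_bij g; have [r gr ->] := raysP w.
exists (g \o r); first exact/aut_geodesic.
apply/seteqP; split=> [_ [s [gs [m [n rs]]] <-]|s [gs [m [n rs]]]] /=.
  by split; [exact/aut_geodesic | exists m, n => i /=; rewrite rs].
have sE : s = g \o (k \o s) by apply/funext => i /=; rewrite kg.
exists (k \o s) => //; split; first by apply/aut_geodesic; rewrite -sE.
by exists m, n => i /=; rewrite -rs /= gk.
Qed.

Definition aut_end (w : tree_end T) : tree_end T := TreeEnd (aut_raysP w).

Lemma aut_edgeP (e : edge T) :
  exists u v, adj u v /\ g @` endpoints e = [set u; v].
Proof.
have [u [v [uv ->]]] := endpointsP e.
by exists (g u), (g v); rewrite aut_adj image_setU !image_set1.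
Qed.

Definition aut_edge (e : edge T) : edge T := Edge (aut_edgeP e).

Lemma aut_end_rayE (w : tree_end T) r : rays (aut_end w) (g \o r) <-> rays w r.
Proof.
split=> [[s ws sr]|wr]; last by exists r.
suff <- : s = r by [].
by apply/funext => i; apply: aut_inj; rewrite -[LHS]/((g \o s) i) sr.
Qed.

Lemma aut_vindex v v0 w : vindex (g v) (g v0) (aut_end w) = vindex v v0 w.
Proof.
rewrite /vindex; congr (xget 0%R _); apply/seteqP; split=> n /=.
- move=> [_ [[r wr <-] /aut_inj r0]] nr; exists r => //.
  by apply: filterS nr => i; rewrite /= !aut_dist.
- move=> [r [wr r0] nr]; exists (g \o r).
    by split; [exact/aut_end_rayE | rewrite /= r0].
  by apply: filterS nr => i; rewrite /= !aut_dist.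
Qed.

Lemma aut_closer w u v : closer (aut_end w) (g u) (g v) <-> closer w u v.
Proof.
split.
- move=> [_ [r wr <-] nr]; exists r => //.
  by apply: filterS nr => i; rewrite /= !aut_dist.
- move=> [r wr nr]; exists (g \o r); first exact/aut_end_rayE.
  by apply: filterS nr => i; rewrite /= !aut_dist.
Qed.

Lemma aut_near_endpoint (e : edge T) w u :
  near_endpoint (aut_edge e) (aut_end w) (g u) <-> near_endpoint e w u.
Proof.
split.
- move=> [[u' eu' /aut_inj uE] [_ [v ev <-] /aut_closer uv]].
  by split; [rewrite -uE | exists v].
- move=> [eu [v ev uv]]; split; first by exists u.
  by exists (g v); [exists v | exact/aut_closer].
Qed.

Lemma aut_eindex e e0 w :
  eindex (aut_edge e) (aut_edge e0) (aut_end w) = eindex e e0 w.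
Proof.
rewrite /eindex; congr (xget 0%R _); apply/seteqP; split=> n /=.
- move=> [gu [gu0 [hu hu0 ->]]].
  move: (hu) (hu0) => [[u _ uE] _] [[u0 _ u0E] _]; subst gu gu0.
  by exists u, u0; rewrite aut_vindex; split=> //; exact/aut_near_endpoint.
- move=> [u [u0 [hu hu0 ->]]]; exists (g u), (g u0).
  by rewrite aut_vindex; split=> //; exact/aut_near_endpoint.
Qed.

Lemma aut_edge_surj (e : edge T) : exists e', aut_edge e' = e.
Proof.
have [k gk kg] := aut_bij g; have [u [v [uv eE]]] := endpointsP e.
have kuv : adj (k u) (k v) by rewrite -(aut_adj g) !kg.
exists (Edge (ex_intro _ (k u) (ex_intro _ (k v) (conj kuv erefl)))).
case: e eE => E EP /= EE; subst E.
rewrite /aut_edge; set P := aut_edgeP _; move: P => /=.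
by rewrite image_setU !image_set1 !kg => P; congr Edge; exact: Prop_irrelevance.
Qed.

Lemma aut_vcarrierP (h : vhorosphere T) :
  exists v0 n, g @` vcarrier h = vlevel v0 (aut_end (vtangency h)) n.
Proof.
have [k gk kg] := aut_bij g; have [v0 [n ->]] := vcarrierP h.
exists (g v0), n; apply/seteqP; split=> [_ [v vn <-]|v vn] /=.
  by rewrite /vlevel /= aut_vindex.
by exists (k v); rewrite ?kg // /vlevel /= -aut_vindex kg.
Qed.

Lemma aut_ecarrierP (h : ehorosphere T) :
  exists e0 n, aut_edge @` ecarrier h = elevel e0 (aut_end (etangency h)) n.
Proof.
have [e0 [n ->]] := ecarrierP h.
exists (aut_edge e0), n; apply/seteqP; split=> [_ [e en <-]|ge en] /=.
  by rewrite /elevel /= aut_eindex.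
have [e eE] := aut_edge_surj ge; subst ge.
by exists e => //; rewrite /elevel /= -aut_eindex.
Qed.

Definition aut_vhoro (h : vhorosphere T) : vhorosphere T :=
  VHorosphere (aut_vcarrierP h).

Definition aut_ehoro (h : ehorosphere T) : ehorosphere T :=
  EHorosphere (aut_ecarrierP h).

End AutAction.

(* Main.v *)
Require Import Defs.
From mathcomp Require Import all_boot all_order all_algebra.
From mathcomp Require Import boolp classical_sets functions topology.
From mathcomp Require Import cardinality filter zify.

Set Implicit Arguments.
Unset Strict Implicit.
Unset Printing Implicit Defensive.

Import Order.TTheory GRing.Theory Num.Theory.
Local Open Scope classical_set_scope.

(** Fix an end w. The index vindex is a cocycle that changes by 1 or -1 along
    every edge, so its parity does not depend on w; and it is locally constant
    in w, because the ends for which a given edge is traversed in a given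
    direction form an arc. In the charts of o and eo every map
    (w, n) |-> (w, n + c w) with c locally constant is therefore a bundle
    isomorphism: the canonical correspondence is the case
    c w = 1 + vindex o (head eo w) w, and a suitable difference of indices
    carries one special section to another. An isomorphism matching two pairs of
    special sections would give eindex e e0 (phi w) = vindex v v0 w with phi
    onto. If e = e0 the left side vanishes and the right side does not; if
    e <> e0 the parity of the left side varies, since some two ends agree on the
    near endpoint of e0 but not on that of e. *)

(** * Distance in a tree *)

(** A walk exists by connectedness and a shortest one by well-ordering, so the default value in
    [dist] is never taken. *)
Lemma dist_spec (T : tree) (u v : T) :
  walk u v (dist u v) /\ forall n, walk u v n -> (dist u v <= n)%N.
Proof.
suff /(xgetPex 0%N) : exists n,
  [set n | walk u v n /\ forall m, walk u v m -> (n <= m)%N] n by [].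
have [p pp lp] := tree_connected u v.
have wP : exists n, `[< walk u v n >].
  by exists (size p); apply/asboolP; exists p.
by case: (ex_minnP wP) => n /asboolP wn mn; exists n; split=> // m wm;
  exact/mn/asboolP.
Qed.

Lemma dist_le_walk (T : tree) (u v : T) n : walk u v n -> (dist u v <= n)%N.
Proof. by have [_] := dist_spec u v; apply. Qed.

Lemma distxx (T : tree) (u : T) : dist u u = 0%N.
Proof. by apply/eqP; rewrite -leqn0; apply: dist_le_walk; exists [::]. Qed.

Lemma dist_eq0 (T : tree) (u v : T) : dist u v = 0%N -> u = v.
Proof.
by have [[p [_ lp sp]] _] := dist_spec u v => d0; move: lp sp; rewrite d0;
  case: p.
Qed.

Lemma dist_triangle (T : tree) (u v x : T) :
  (dist u x <= dist u v + dist v x)%N.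
Proof.
have [[p [pp lp sp]] _] := dist_spec u v.
have [[p' [pp' lp' sp']] _] := dist_spec v x.
apply: dist_le_walk; exists (p ++ p'); split.
- by rewrite cat_path pp lp.
- by rewrite last_cat lp.
- by rewrite size_cat sp sp'.
Qed.

Lemma rev_walk (T : tree) (u : T) (p : seq T) : path adj u p ->
  exists p', [/\ path adj (last u p) p', last (last u p) p' = u,
    size p' = size p & {subset p' <= u :: p}].
Proof.
move=> pp; exists (rev (belast u p)); split.
- by rewrite rev_path; apply: sub_path pp => x y /=; rewrite adj_sym.
- by case: p {pp} => //= x p; rewrite rev_cons last_rcons.
- by rewrite size_rev size_belast.
- by move=> x; rewrite mem_rev => /mem_belast.
Qed.

Lemma dist_sym (T : tree) (u v : T) : dist u v = dist v u.
Proof.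
suff le (x y : T) : (dist x y <= dist y x)%N by apply/eqP; rewrite eqn_leq !le.
have [[p [pp lp sp]] _] := @dist_spec T y x.
by have [p' []] := rev_walk pp; rewrite lp sp => ? ? ? _;
  apply: dist_le_walk; exists p'.
Qed.

Lemma adj_neq (T : tree) (u v : T) : adj u v -> u <> v.
Proof. by move=> + uv; rewrite uv adj_irr. Qed.

Lemma dist_adj (T : tree) (u v : T) : adj u v -> dist u v = 1%N.
Proof.
move=> uv; have : (dist u v <= 1)%N.
  by apply: dist_le_walk; exists [:: v]; rewrite /= uv.
have := @dist_eq0 T u v; have := adj_neq uv.
by case: (dist u v) => [nuv uv0|n]; [case: nuv; exact: uv0 | lia].
Qed.

Lemma adj_dist1 (T : tree) (u v : T) : dist u v = 1%N -> adj u v.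
Proof.
have [[p [pp lp sp]] _] := dist_spec u v; move=> d1; move: pp lp sp.
by rewrite d1; case: p => [|x [|]] //= /andP[ux _] <-.
Qed.

Lemma dist_adj_le (T : tree) (z x y : T) : adj x y ->
  (dist z y <= (dist z x).+1)%N.
Proof.
by move=> xy; have := dist_triangle z x y; rewrite (dist_adj xy) addn1.
Qed.

(** A proper prefix of a shortest walk is shorter than it, so every vertex before the end is nearer
    to [z]; this certifies that a geodesic avoids a given vertex. *)
Lemma geodesic_path (T : tree) (z x : T) : exists p : seq T,
  [/\ path adj z p, last z p = x &
      forall y, y \in z :: p -> y = x \/ (dist z y < dist z x)%N].
Proof.
have [[p [pp lp sp]] _] := dist_spec z x.
exists p; split=> // y; rewrite -sp => yp.
case/splitPl: yp lp pp => p1 p2 l1; rewrite last_cat l1 cat_path size_cat.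
case: p2 => [/= <-|t p2 _ /andP[pp1 _]]; first by left.
right; suff : (dist z y <= size p1)%N.
  by move=> /leq_ltn_trans; apply; rewrite /= addnS ltnS leq_addr.
by apply: dist_le_walk; exists p1.
Qed.

(** The reversed first walk followed by the second joins [y1] to [y2] off [x]; made simple and
    closed through [x] it is a forbidden cycle. Acyclicity enters only here. *)
Lemma no_bypass (T : tree) (z x y1 y2 : T) (p1 p2 : seq T) :
  adj x y1 -> adj x y2 -> y1 <> y2 ->
  path adj z p1 -> last z p1 = y1 -> x \notin z :: p1 ->
  path adj z p2 -> last z p2 = y2 -> x \notin z :: p2 -> False.
Proof.
move=> xy1 xy2 y12 pp1 l1 xp1 pp2 l2 xp2.
have [p [pp lp _ sp]] := rev_walk pp1; rewrite l1 in pp lp.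
have ppp : path adj y1 (p ++ p2) by rewrite cat_path pp lp.
have lpp : last y1 (p ++ p2) = y2 by rewrite last_cat lp.
have xpp : x \notin y1 :: (p ++ p2).
  rewrite in_cons mem_cat !negb_or; apply/and3P; split.
  - by apply/eqP => xE; move: xy1; rewrite -xE adj_irr.
  - by apply: contra xp1; exact: sp.
  - by move: xp2; rewrite in_cons negb_or => /andP[].
case/shortenP: ppp lpp xpp => r pr ur sr lr; rewrite in_cons negb_or => /andP[xy xr].
have {}sr : x \notin r by apply: contra xr; exact: sr.
apply: (@tree_acyclic T (x :: y1 :: r)).
  by case: r lr {pr ur sr} => //= /y12.
rewrite /ucycle /ucycleb; apply/andP; split.
  by rewrite /= rcons_path xy1 pr lr /= adj_sym.
by rewrite cons_uniq ur in_cons negb_or xy sr.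
Qed.

(** Geodesics from [z] to [y1] and to [y2] would both avoid [x], which is farther from [z] than
    either. *)
Lemma closer_neighbour_uniq (T : tree) (z x y1 y2 : T) : adj x y1 -> adj x y2 ->
  dist z x = (dist z y1).+1 -> dist z x = (dist z y2).+1 -> y1 = y2.
Proof.
move=> xy1 xy2 d1 d2; apply: contrapT => y12.
have [p1 [pp1 l1 s1]] := geodesic_path z y1.
have [p2 [pp2 l2 s2]] := geodesic_path z y2.
apply: (no_bypass xy1 xy2 y12 pp1 l1 _ pp2 l2).
- by apply/negP => /s1[xE|]; [rewrite xE in d1; lia | lia].
- by apply/negP => /s2[xE|]; [rewrite xE in d2; lia | lia].
Qed.

Lemma closer_neighbour (T : tree) (z x : T) : z <> x ->
  exists2 y, adj x y & dist z x = (dist z y).+1.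
Proof.
move=> zx; have [[p [pp lp sp]] _] := dist_spec z x.
case/lastP: p pp lp sp => [|p t]; first by move=> _ /= /zx.
rewrite rcons_path last_rcons size_rcons => /andP[pp tx] tE sp; subst t.
exists (last z p); first by rewrite adj_sym.
apply/eqP; rewrite eqn_leq -{2}sp ltnS dist_adj_le //=.
by apply: dist_le_walk; exists p.
Qed.

(** Trees are bipartite: if [x] and [y] were equally far from [z], then [y] and the neighbour of [x]
    towards [z] could both be reached from [z] without passing [x]. *)
Lemma dist_adjP (T : tree) (z x y : T) : adj x y ->
  dist z y = (dist z x).+1 \/ dist z x = (dist z y).+1.
Proof.
move=> xy; have yx : adj y x by rewrite adj_sym.
have := dist_adj_le z xy; have := dist_adj_le z yx.
case: (ltngtP (dist z x) (dist z y)) => [lt|lt|dE] l1 l2; try lia.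
have zx : z <> x.
  by move=> zE; subst z; move: dE; rewrite distxx => /esym/dist_eq0 /(adj_neq xy).
have [x' xx' dx'] := closer_neighbour zx.
have x'y : x' <> y by move=> x'E; move: dx'; rewrite x'E; lia.
have [p1 [pp1 h1 s1]] := geodesic_path z x'.
have [p2 [pp2 h2 s2]] := geodesic_path z y.
exfalso; apply: (no_bypass xx' xy x'y pp1 h1 _ pp2 h2).
- by apply/negP => /s1[xE|]; [rewrite -xE in dx'; lia | lia].
- by apply/negP => /s2[xE|]; [exact: adj_neq xy xE | lia].
Qed.

(** Only one neighbour of [v] is nearer to [z], and it is [u]. *)
Lemma forward_step (T : tree) (z u v y : T) : adj u v -> adj v y -> y <> u ->
  dist z v = (dist z u).+1 -> dist z y = (dist z v).+1.
Proof.
move=> uv vy yu dv; have [//|dy] := dist_adjP z vy.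
by case: yu; apply: (closer_neighbour_uniq vy _ dy dv); rewrite adj_sym.
Qed.

(* Only the degenerate square, in which the two edges coincide, closes up. *)
Lemma square_degenerate (T : tree) (a b c d : T) : adj a b -> adj c d ->
  dist a d = (dist a c).+1 -> dist b c = (dist a c).+1 ->
  dist b d = dist a c -> a = c /\ b = d.
Proof.
move=> ab cd ad bc bd; have ba : adj b a by rewrite adj_sym.
case: (pselect (a = c)) => [ac|ac].
  by split=> //; apply: dist_eq0; rewrite bd ac distxx.
(* The neighbour [p] of [c] towards [a] is also the one towards [b], hence is [d]; but [d] is
   farther from [a] than [c]. *)
have [p cp acp] := closer_neighbour ac.
have := dist_adj_le p ab; rewrite dist_sym [dist p a]dist_sym => bp.
have := dist_adjP b cp => bcp.
have pd : p = d by apply: (@closer_neighbour_uniq T b c) => //; lia.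
by move: ad; rewrite -pd; lia.
Qed.

(** * Rays and ends *)

Definition nonbacktracking (T : tree) (r : nat -> T) : Prop :=
  forall i, adj (r i) (r i.+1) /\ r i.+2 <> r i.

Lemma nonbacktracking_forward (T : tree) (r : nat -> T) z i :
  nonbacktracking r -> dist z (r i.+1) = (dist z (r i)).+1 ->
  forall j, dist z (r (i + j)%N) = (dist z (r i) + j)%N.
Proof.
move=> nr di; suff H j : dist z (r (i + j)%N) = (dist z (r i) + j)%N /\
    dist z (r (i + j).+1) = (dist z (r i) + j.+1)%N by move=> j; have [] := H j.
elim: j => [|j [IH1 IH2]]; first by rewrite !addn0 di addn1.
rewrite addnS; split=> //.
have [a1 n1] := nr (i + j)%N; have [a2 _] := nr (i + j).+1.
by rewrite (forward_step (z := z) a1 a2) //; lia.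
Qed.

(** A local test for geodesics: seen from [r i], the first step moves away, hence so does every
    later one. *)
Lemma geodesic_rayP (T : tree) (r : nat -> T) :
  geodesic_ray r <-> nonbacktracking r.
Proof.
split=> [gr i|nr i j ij].
  split; first by apply: adj_dist1; rewrite gr //; lia.
  by move=> rE; have := gr i i.+2 ltac:(lia); rewrite rE distxx; lia.
have [ai _] := nr i; have -> : j = (i + (j - i))%N by lia.
by rewrite (nonbacktracking_forward (z := r i)) ?distxx ?(dist_adj ai) //; lia.
Qed.

(** A ray that never moved away from [z] would come nearer at every step, beyond what its initial
    distance allows. *)
Lemma ray_eventually_forward (T : tree) (r : nat -> T) z : geodesic_ray r ->
  exists N, forall j, dist z (r (N + j)%N) = (dist z (r N) + j)%N.
Proof.
move=> /geodesic_rayP nr.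
have [[N dN]|noN] := pselect (exists N, dist z (r N.+1) = (dist z (r N)).+1).
  by exists N => j; exact: nonbacktracking_forward.
have back n : dist z (r 0%N) = (dist z (r n) + n)%N.
  elim: n => [|n IH]; first by rewrite addn0.
  have [an _] := nr n; have [dn|dn] := dist_adjP z an; last lia.
  by case: noN; exists n.
by have := back (dist z (r 0%N)).+1; lia.
Qed.

Lemma end_ray (T : tree) (w : tree_end T) : exists r, rays w r.
Proof.
by have [r gr ->] := raysP w; exists r; split=> //; exists 0%N, 0%N.
Qed.

Lemma rays_geodesic (T : tree) (w : tree_end T) r : rays w r -> geodesic_ray r.
Proof. by have [s gs ->] := raysP w => -[]. Qed.

Lemma rays_cofinal (T : tree) (w : tree_end T) r s :
  rays w r -> rays w s -> cofinal r s.
Proof.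
have [t gt ->] := raysP w => -[_ [m [n tr]]] [_ [m' [n' ts]]].
exists (n + m')%N, (n' + m)%N => i; rewrite -!addnA -tr -ts; congr t; lia.
Qed.

Lemma cofinal_rays (T : tree) (w : tree_end T) r s :
  rays w r -> geodesic_ray s -> cofinal r s -> rays w s.
Proof.
have [t gt ->] := raysP w => -[_ [m [n tr]]] gs [m' [n' rs]]; split=> //.
exists (m + m')%N, (n' + n)%N => i; rewrite -!addnA tr -rs; congr r; lia.
Qed.

(** The hypothesis says that a geodesic from [v] to [r N] followed by the tail of [r] stays
    geodesic. Induction on [d], stepping from [v] to its neighbour towards [r N]. *)
Lemma ray_prepend (T : tree) (r : nat -> T) N d v : geodesic_ray r ->
  (forall j, dist v (r (N + j)%N) = (d + j)%N) ->
  exists s, [/\ geodesic_ray s, s 0%N = v &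
                forall j, s (d + j)%N = r (N + j)%N].
Proof.
move=> gr; elim: d v => [|d IH] v dv.
  exists (fun j => r (N + j)%N); split=> //.
    by move=> i j ij; rewrite gr; lia.
  by apply/esym/dist_eq0; rewrite dv.
have rv : r (N + 0)%N <> v by move=> vE; have := dv 0%N; rewrite vE distxx.
have [y vy dy] := closer_neighbour rv.
have [|s [gs s0 sr]] := IH y.
  move=> j; apply/eqP; rewrite eqn_leq; apply/andP; split.
    have := dist_triangle y (r (N + 0)%N) (r (N + j)%N).
    rewrite gr; last lia.
    by have := dv 0%N; rewrite dist_sym dy dist_sym; lia.
  have := dist_triangle v y (r (N + j)%N).
  by rewrite (dist_adj vy) dv; lia.
exists (fun i => if i is i'.+1 then s i' else v); split=> //.
apply/geodesic_rayP => -[|i]; last by have /geodesic_rayP := gs; apply.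
split; first by rewrite s0.
(* No backtracking at the front: [s 1 = v] would put [v] at distance [d] instead of [d.+2] from
   [r (N + 1)]. *)
move=> s1; have := gs 1%N (d + 1)%N ltac:(lia); rewrite s1 sr dv; lia.
Qed.

Lemma ray_from_exists (T : tree) (v : T) (w : tree_end T) :
  exists r, ray_from v w r.
Proof.
have [r wr] := end_ray w; have gr := rays_geodesic wr.
have [N dN] := ray_eventually_forward v gr.
have [s [gs s0 sr]] := ray_prepend gr dN.
exists s; split=> //; apply: cofinal_rays wr gs _.
by exists N, (dist v (r N)) => i; rewrite sr.
Qed.

(** * The vertex-horospherical index *)

(** The definition uses the ray from [v0]; any ray of [w] will do, since cofinal rays share a tail,
    and the difference of distances is eventually constant. *)
Lemma vindex_ray (T : tree) (v v0 : T) (w : tree_end T) r : rays w r ->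
  exists N, forall i, (N <= i)%N ->
    vindex v v0 w = ((dist v0 (r i))%:Z - (dist v (r i))%:Z)%R.
Proof.
move=> wr.
have /(xgetPex 0%R) : exists n, [set n : int | exists2 r, ray_from v0 w r &
    \forall i \near \oo, n = ((dist v0 (r i))%:Z - (dist v (r i))%:Z)%R] n.
  have [s [ws s0]] := ray_from_exists v0 w; have gs := rays_geodesic ws.
  have [N dN] := ray_eventually_forward v gs.
  have [M dM] := ray_eventually_forward v0 gs.
  (* From [M] and [N] on both distances grow by one per step; this is their constant difference. *)
  exists ((dist v0 (s M))%:Z - M%:Z - (dist v (s N))%:Z + N%:Z)%R; exists s => //.
  exists (maxn N M) => // i /= iNM.
  have := dM (i - M)%N; have := dN (i - N)%N.
  by rewrite !subnKC; lia.
rewrite -[xget _ _]/(vindex v v0 w) => -[s [ws _] [M _ HM]].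
have [m [n sr]] := rays_cofinal ws wr.
exists (n + M)%N => i iM; have := HM (m + (i - n))%N.
rewrite /= sr; have -> : (n + (i - n) = i)%N by lia.
by apply; lia.
Qed.

Lemma vindexD (T : tree) (w : tree_end T) (u v z : T) :
  vindex u z w = (vindex u v w + vindex v z w)%R.
Proof.
have [r wr] := end_ray w.
have [N1 H1] := vindex_ray u z wr; have [N2 H2] := vindex_ray u v wr.
have [N3 H3] := vindex_ray v z wr.
by rewrite (H1 (N1 + N2 + N3)%N) ?(H2 (N1 + N2 + N3)%N) ?(H3 (N1 + N2 + N3)%N);
  lia.
Qed.

Lemma vindexxx (T : tree) (w : tree_end T) (v : T) : vindex v v w = 0%R.
Proof. by have := vindexD w v v v; lia. Qed.

Lemma vindexN (T : tree) (w : tree_end T) (u v : T) :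
  vindex u v w = (- vindex v u w)%R.
Proof. by have := vindexD w u v u; rewrite vindexxx; lia. Qed.

Lemma vindex_adj (T : tree) (w : tree_end T) (u v : T) : adj u v ->
  vindex u v w = 1%R \/ vindex u v w = (- 1)%R.
Proof.
move=> uv; have [r wr] := end_ray w; have [N HN] := vindex_ray u v wr.
rewrite (HN N) // ![dist _ (r N)]dist_sym.
by have [|] := dist_adjP (r N) uv; lia.
Qed.

Lemma closerP (T : tree) (w : tree_end T) (u v : T) :
  closer w u v <-> (0 < vindex u v w)%R.
Proof.
split=> [[r wr [M _ HM]]|].
  have [N HN] := vindex_ray u v wr.
  by rewrite (HN (N + M)%N); [have /= := HM (N + M)%N; lia | lia].
have [r wr] := end_ray w; have [N HN] := vindex_ray u v wr => uv.
exists r => //; exists N => // i /= Ni.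
by move: uv; rewrite (HN i) //; lia.
Qed.

Lemma vindex_ray_step (T : tree) (w : tree_end T) r : rays w r ->
  vindex (r 1%N) (r 0%N) w = 1%R.
Proof.
move=> wr; have gr := rays_geodesic wr.
have [N HN] := vindex_ray (r 1%N) (r 0%N) wr.
by rewrite (HN N.+1) ?leqnSn // !gr //; lia.
Qed.

(** This [u] is v_+, the second vertex of the ray from [v] to [w]; [succ_uniq] gives its
    uniqueness. *)
Lemma succ_exists (T : tree) (w : tree_end T) (v : T) :
  exists2 u, adj v u & vindex u v w = 1%R.
Proof.
have [r [wr <-]] := ray_from_exists v w; exists (r 1%N).
  by apply: adj_dist1; rewrite (rays_geodesic wr).
exact: vindex_ray_step.
Qed.

Lemma succ_uniq (T : tree) (w : tree_end T) (v u u' : T) :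
  adj v u -> adj v u' -> vindex u v w = 1%R -> vindex u' v w = 1%R -> u = u'.
Proof.
move=> vu vu' h h'; have [r wr] := end_ray w.
have [N HN] := vindex_ray u v wr; have [N' HN'] := vindex_ray u' v wr.
have := HN (N + N')%N ltac:(lia); have := HN' (N + N')%N ltac:(lia).
rewrite h h' ![dist _ (r _)]dist_sym => d d'.
by apply: (closer_neighbour_uniq (z := r (N + N')%N) vu vu'); lia.
Qed.

(** Ties the topology of the ends to the index: [v] lies on the ray from [u] exactly when it is the
    successor of [u] towards [w]. *)
Lemma arcP (T : tree) (w : tree_end T) (u v : T) : adj u v ->
  Defs.arc u v w <-> vindex v u w = 1%R.
Proof.
move=> uv; split=> [[r [wr r0] [i ri]]|h].
  have := rays_geodesic wr (leq0n i); rewrite r0 ri (dist_adj uv) subn0 => i1.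
  by rewrite -r0 -ri -i1; exact: vindex_ray_step.
have [r [wr r0]] := ray_from_exists u w; exists r => //; exists 1%N.
apply: (@succ_uniq T w u) => //; last by rewrite -r0; exact: vindex_ray_step.
by rewrite -r0; apply: adj_dist1; rewrite (rays_geodesic wr).
Qed.

(* A walk of length n moves the index by n steps of size 1, whatever the end:
   the parity of the index does not depend on the end. *)
Lemma vindex_parity (T : tree) (u v : T) (w w' : tree_end T) :
  exists k : int, (vindex v u w - vindex v u w' = k + k)%R.
Proof.
have [p] := tree_connected u v.
elim: p u => [u _ /= <-|x p IH u /= /andP[ux px] lp].
  by exists 0%R; rewrite !vindexxx; lia.
have [k hk] := IH x px lp.
rewrite (vindexD w v x u) (vindexD w' v x u).
have xu : adj x u by rewrite adj_sym.
have := vindex_adj w xu; have := vindex_adj w' xu.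
move=> [->|->] [->|->]; first [by exists k; lia | by exists (k + 1)%R; lia |
  by exists (k - 1)%R; lia].
Qed.

(** * Branching, and the construction of ends *)

Lemma third_neighbour (T : tree) q (v x1 x2 : T) : (2 <= q)%N ->
  homogeneous T q -> exists y, [/\ adj v y, y <> x1 & y <> x2].
Proof.
move=> q2 /(_ v) /card_set_bijP[f [_ _ fsurj]].
have pre i : (i <= 2)%N -> exists2 y, adj v y & f y = i.
  by move=> i2; apply: fsurj => /=; lia.
have [y0 a0 f0] := pre 0%N isT; have [y1 a1 f1] := pre 1%N isT.
have [y2 a2 f2] := pre 2%N isT.
apply: contrapT => noy.
have mem y : adj v y -> y = x1 \/ y = x2.
  by move=> vy; apply: contrapT => /not_orP[? ?]; apply: noy; exists y.
by have [|] := mem _ a0; have [|] := mem _ a1; have [|] := mem _ a2; congruence.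
Qed.

(** Prolong the edge to a ray from [u] through [v] without backtracking. It moves away forever from
    every [z] nearer to [u] than to [v], so the index of [v] over [z] is the full distance. *)
Lemma forward_end (T : tree) q (u v : T) : (2 <= q)%N -> homogeneous T q ->
  adj u v -> exists w : tree_end T, forall z,
    dist z v = (dist z u).+1 -> vindex v z w = ((dist z v)%:Z)%R.
Proof.
move=> q2 hom uv.
(* A directed edge is continued by a neighbour of its tip other than its origin; [st] iterates this
   on directed edges. *)
have /choice[next nextP] : forall e : T * T, exists y, adj e.2 y /\ y <> e.1.
  by move=> [x y]; have [t []] := third_neighbour y x x q2 hom; exists t.
pose st n := iter n (fun e => (e.2, next e)) (u, v).
pose r n := (st n).1.
have gr : geodesic_ray r.
  apply/geodesic_rayP; case=> [|i]; split; rewrite /r /=.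
  - by [].
  - by case: (nextP (u, v)).
  - by case: (nextP (st i)).
  - by case: (nextP ((st i).2, next (st i))).
pose w : tree_end T := TreeEnd (ex_intro2 _ _ r gr erefl).
have wr : rays w r by split=> //; exists 0%N, 0%N.
exists w => z zv; have [N HN] := vindex_ray v z wr.
have nr := (geodesic_rayP r).1 gr.
have := nonbacktracking_forward (i := 0%N) nr zv N.+1; rewrite add0n => zr.
have := gr 1%N N.+1 isT; rewrite (HN N.+1) // zr -[r 1%N]/v -[r 0%N]/u; lia.
Qed.

(** * Edges *)

Lemma edge_eq (T : tree) (e e' : edge T) : endpoints e = endpoints e' -> e = e'.
Proof.
case: e e' => [E P] [E' P'] /= EE; subst E'.
by congr Edge; exact: Prop_irrelevance.
Qed.

Lemma near_endpoint_exists (T : tree) (e : edge T) (w : tree_end T) :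
  exists u, near_endpoint e w u.
Proof.
have [a [b [ab eE]]] := endpointsP e.
have [h|h] := vindex_adj w ab.
  exists a; split; rewrite eE; first by left.
  by exists b; [right | apply/closerP; rewrite h].
exists b; split; rewrite eE; first by right.
by exists a; [left | apply/closerP; rewrite vindexN h].
Qed.

(** [near_endpoint] is a relation; this picks v(e, w) as a function. By [near_endpointE] nothing
    depends on the choice. *)
Definition head (T : tree) (e : edge T) (w : tree_end T) : T :=
  sval (cid (near_endpoint_exists e w)).

Lemma near_endpointE (T : tree) (e : edge T) (w : tree_end T) (a b u : T) :
  adj a b -> endpoints e = [set a; b] -> vindex b a w = 1%R ->
  near_endpoint e w u -> u = b.
Proof.
rewrite /near_endpoint => ab -> h [[->|->] //] [v [->|->]] /closerP //.
  by rewrite vindexxx.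
by rewrite vindexN h.
Qed.

Lemma headE (T : tree) (e : edge T) (w : tree_end T) (a b : T) :
  adj a b -> endpoints e = [set a; b] -> vindex b a w = 1%R -> head e w = b.
Proof.
by move=> ab eE h; rewrite /head; case: cid => u /= /(near_endpointE ab eE h).
Qed.

Lemma head_tail (T : tree) (e : edge T) (w : tree_end T) : exists t,
  [/\ adj t (head e w), endpoints e = [set t; head e w] &
      vindex (head e w) t w = 1%R].
Proof.
have [a [b [ab eE]]] := endpointsP e; have ba : adj b a by rewrite adj_sym.
have [h|h] := vindex_adj w ab.
  have eE' : endpoints e = [set b; a] by rewrite eE setUC.
  by exists b; rewrite (headE ba eE' h).
have h' : vindex b a w = 1%R by rewrite vindexN h.
by exists a; rewrite (headE ab eE h').
Qed.

Lemma eindexE (T : tree) (e e0 : edge T) (w : tree_end T) :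
  eindex e e0 w = vindex (head e w) (head e0 w) w.
Proof.
have headP (f : edge T) : near_endpoint f w (head f w).
  by rewrite /head; case: cid.
have near_head (f : edge T) u : near_endpoint f w u -> u = head f w.
  by have [t [tf fE h]] := head_tail f w; exact: (near_endpointE tf fE h).
rewrite /eindex; apply: xget_unique; first by exists (head e w), (head e0 w).
by move=> n [u [u0 [/near_head-> /near_head-> ->]]].
Qed.

Lemma eindexD (T : tree) (w : tree_end T) (e e1 e2 : edge T) :
  eindex e e2 w = (eindex e e1 w + eindex e1 e2 w)%R.
Proof. by rewrite !eindexE; exact: vindexD. Qed.

Lemma eindexxx (T : tree) (w : tree_end T) (e : edge T) : eindex e e w = 0%R.
Proof. by rewrite eindexE vindexxx. Qed.

(** * Levels and charts *)

(** A nonempty level set determines its index, so the charts can read it back. Upwards follow the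
    successor; downwards take another neighbour, which exists as [q] is at least 2. *)
Lemma vlevel_inhabited (T : tree) q (v0 : T) (w : tree_end T) (n : int) :
  (2 <= q)%N -> homogeneous T q -> exists v, vlevel v0 w n v.
Proof.
move=> q2 hom; rewrite /vlevel /=.
have up k : exists v, vindex v v0 w = (k%:Z)%R.
  elim: k => [|k [v hv]]; first by exists v0; rewrite vindexxx.
  have [u _ hu] := succ_exists w v.
  by exists u; rewrite (vindexD w u v v0) hu hv; lia.
have down k : exists v, vindex v v0 w = (- k%:Z)%R.
  elim: k => [|k [v hv]]; first by exists v0; rewrite vindexxx.
  have [u vu hu] := succ_exists w v.
  have [y [vy yu _]] := third_neighbour v u u q2 hom.
  have yv : adj y v by rewrite adj_sym.
  exists y; rewrite (vindexD w y v v0) hv.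
  have [hy|->] := vindex_adj w yv; last lia.
  by case: yu; exact: (succ_uniq vy vu hy hu).
case: n => k; first exact: up.
by have [v hv] := down k.+1; exists v; rewrite hv NegzE.
Qed.

Lemma elevel_inhabited (T : tree) q (e0 : edge T) (w : tree_end T) (n : int) :
  (2 <= q)%N -> homogeneous T q -> exists e, elevel e0 w n e.
Proof.
(* The near endpoint of the edge from [v] to its successor is the successor, one level up; hence
   [n - 1]. *)
move=> q2 hom; have [v vn] := vlevel_inhabited (head e0 w) w (n - 1)%R q2 hom.
have [u vu hu] := succ_exists w v.
exists (Edge (ex_intro _ v (ex_intro _ u (conj vu erefl)))).
rewrite /elevel /= eindexE (@headE _ _ _ v u) // (vindexD w u v) hu vn; lia.
Qed.

Lemma vhorosphere_eq (T : tree) (h h' : vhorosphere T) :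
  vtangency h = vtangency h' -> vcarrier h = vcarrier h' -> h = h'.
Proof.
case: h h' => [w C P] [w' C' P'] /= ww CC; subst w' C'.
by congr VHorosphere; exact: Prop_irrelevance.
Qed.

Lemma ehorosphere_eq (T : tree) (h h' : ehorosphere T) :
  etangency h = etangency h' -> ecarrier h = ecarrier h' -> h = h'.
Proof.
case: h h' => [w C P] [w' C' P'] /= ww CC; subst w' C'.
by congr EHorosphere; exact: Prop_irrelevance.
Qed.

(** By the cocycle identity a change of base vertex shifts the levels at a given end by a
    constant. *)
Lemma vhoro_atP (T : tree) (v0 : T) (h : vhorosphere T) :
  exists n, h = vhoro_at v0 (vtangency h) n.
Proof.
have [u [n hE]] := vcarrierP h.
exists (n + vindex u v0 (vtangency h))%R; apply: vhorosphere_eq => //=.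
by rewrite hE; apply/seteqP; split=> v; rewrite /vlevel /=;
  rewrite (vindexD _ v u v0); lia.
Qed.

Lemma ehoro_atP (T : tree) (e0 : edge T) (h : ehorosphere T) :
  exists n, h = ehoro_at e0 (etangency h) n.
Proof.
have [u [n hE]] := ecarrierP h.
exists (n + eindex u e0 (etangency h))%R; apply: ehorosphere_eq => //=.
by rewrite hE; apply/seteqP; split=> v; rewrite /elevel /=;
  rewrite (eindexD _ v u e0); lia.
Qed.

Lemma vchart_at (T : tree) q (v0 : T) (w : tree_end T) (n : int) :
  (2 <= q)%N -> homogeneous T q -> vchart v0 (vhoro_at v0 w n) = (w, n).
Proof.
move=> q2 hom; congr pair => /=; apply: xget_unique => //= m nm.
have [v vn] := vlevel_inhabited v0 w n q2 hom.
by have := vn; rewrite nm => <-; exact: vn.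
Qed.

Lemma echart_at (T : tree) q (e0 : edge T) (w : tree_end T) (n : int) :
  (2 <= q)%N -> homogeneous T q -> echart e0 (ehoro_at e0 w n) = (w, n).
Proof.
move=> q2 hom; congr pair => /=; apply: xget_unique => //= m nm.
have [v vn] := elevel_inhabited e0 w n q2 hom.
by have := vn; rewrite nm => <-; exact: vn.
Qed.

(** * Local constancy of the indices *)

Definition locally_constant (X : topologicalType) (Y : Type) (f : X -> Y) :
  Prop := forall x, \forall y \near x, f y = f x.

Lemma arc_nbhs (T : tree) (u v : T) (w : tree_end T) : u <> v ->
  Defs.arc u v w -> nbhs w (Defs.arc u v).
Proof.
move=> uv uvw; rewrite nbhsE; exists (Defs.arc u v) => //; split=> //.
exists [set Defs.arc u v]; last by rewrite bigcup_set1.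
by move=> _ ->; apply: (@finI_from1 _ _ _ id); exists u, v.
Qed.

Lemma vindex_locally_constant (T : tree) (u v : T) :
  locally_constant (vindex u v).
Proof.
have [p] := tree_connected v u.
elim: p v => [v _ /= <- w|x p IH v /= /andP[vx px] lp w].
  by near=> w'; rewrite !vindexxx.
have xv : adj x v by rewrite adj_sym.
have loc : \forall w' \near w, vindex x v w' = vindex x v w.
  have [h|h] := vindex_adj w xv.
    have := arc_nbhs (adj_neq vx) ((arcP w vx).2 h); apply: filterS => w'.
    by rewrite h => /(arcP _ vx).
  have h' : vindex v x w = 1%R by rewrite vindexN h.
  have := arc_nbhs (adj_neq xv) ((arcP w xv).2 h'); apply: filterS => w'.
  by rewrite h => /(arcP _ xv) h1; rewrite vindexN h1.
apply: filterS2 loc (IH x px lp w) => w' e1 e2.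
by rewrite (vindexD w' u x v) (vindexD w u x v) e1 e2.
Unshelve. all: by end_near.
Qed.

(** As long as the index of the head over the tail stays 1, the head stays the same. *)
Lemma head_locally_constant (T : tree) (e : edge T) :
  locally_constant (head e).
Proof.
move=> w; have [t [th eE h]] := head_tail e w.
have := @vindex_locally_constant T (head e w) t w.
by apply: filterS => w'; rewrite h; exact: headE.
Qed.

Lemma vindex_head_locally_constant (T : tree) (e : edge T) (v : T) :
  locally_constant (fun w => vindex v (head e w) w).
Proof.
move=> w; have := @vindex_locally_constant T v (head e w) w.
by apply: filterS2 (head_locally_constant e w) => w' /= ->.
Qed.

Lemma eindex_locally_constant (T : tree) (e e0 : edge T) :
  locally_constant (eindex e e0).
Proof.
move=> w; have := @vindex_locally_constant T (head e w) (head e0 w) w.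
apply: filterS3 (head_locally_constant e w) (head_locally_constant e0 w).
by move=> w'; rewrite !eindexE => -> ->.
Qed.

(** * Isomorphisms of the horospherical bundles *)

Lemma shift_continuous (B : topologicalType) (c : B -> int) :
  locally_constant c ->
  continuous (fun p : B * discrete_topology int =>
    (p.1, (p.2 + c p.1)%R : discrete_topology int)).
Proof.
move=> lc [b n]; apply: (@cvg_pair _ _ _ _ (nbhs b)
  (nbhs (n + c b : discrete_topology int)%R)); first exact: cvg_fst.
move=> A /principal_filterP /= An.
suff : \forall p \near (b, n), (p.2 + c p.1)%R = (n + c b)%R.
  by apply: filterS => p /= pE; rewrite /preimage /= pE.
exists ([set b' | c b' = c b], [set n]) => /=.
  by split; [exact: lc | exact/principal_filterP].
by move=> [b' n'] /= [-> ->].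
Qed.

(** For initial topologies along bijective charts, continuity can be tested on the product; the
    inverse map is the shift by [- c]. *)
Lemma shift_homeomorphism (B : topologicalType) (X Y : choiceType)
    (chartX : X -> B * discrete_topology int)
    (chartY : Y -> B * discrete_topology int)
    (atX : B * discrete_topology int -> X)
    (atY : B * discrete_topology int -> Y) (c : B -> int) :
  cancel chartX atX -> cancel atX chartX ->
  cancel chartY atY -> cancel atY chartY -> locally_constant c ->
  @homeomorphism (initial_topology chartX) (initial_topology chartY)
    (fun x => atY ((chartX x).1, ((chartX x).2 + c (chartX x).1)%R)).
Proof.
move=> XK aXK YK aYK lc; split.
  apply: continuous_comp_initial.
  rewrite (_ : _ \o _ = (fun p => (p.1, (p.2 + c p.1)%R)) \o chartX); last first.
    by apply/funext => x /=; rewrite aYK.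
  move=> x; apply: continuous_comp; first exact: initial_continuous.
  exact: shift_continuous.
have lcN : locally_constant (fun b => - c b)%R.
  by move=> b; apply: filterS (lc b) => b' ->.
exists (fun y => atX ((chartY y).1, ((chartY y).2 + - c (chartY y).1)%R)); split.
- by move=> x; rewrite aYK /= addrK -surjective_pairing XK.
- by move=> y; rewrite aXK /= subrK -surjective_pairing YK.
apply: continuous_comp_initial.
rewrite (_ : _ \o _ = (fun p => (p.1, (p.2 + - c p.1)%R)) \o chartY); last first.
  by apply/funext => x /=; rewrite aXK.
move=> x; apply: continuous_comp; first exact: initial_continuous.
exact: (shift_continuous lcN).
Qed.

Lemma homeomorphism_id (X : topologicalType) : @homeomorphism X X id.
Proof. by split=> [x|]; [exact: cvg_id | exists id; split=> // x; exact: cvg_id]. Qed.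

Definition vshift (T : tree) (o : T) (eo : edge T) (c : tree_end T -> int)
    (h : vhorosphere T) : ehorosphere T :=
  ehoro_at eo (vchart o h).1 ((vchart o h).2 + c (vchart o h).1)%R.

Definition eshift (T : tree) (o : T) (eo : edge T) (c : tree_end T -> int)
    (h : ehorosphere T) : vhorosphere T :=
  vhoro_at o (echart eo h).1 ((echart eo h).2 + c (echart eo h).1)%R.

Lemma vchartK (T : tree) q (o : T) : (2 <= q)%N -> homogeneous T q ->
  cancel (vchart o) (fun p => vhoro_at o p.1 p.2).
Proof.
by move=> q2 hom h; have [n ->] := vhoro_atP o h; rewrite (vchart_at _ _ _ q2).
Qed.

Lemma echartK (T : tree) q (eo : edge T) : (2 <= q)%N -> homogeneous T q ->
  cancel (echart eo) (fun p => ehoro_at eo p.1 p.2).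
Proof.
by move=> q2 hom h; have [n ->] := ehoro_atP eo h; rewrite (echart_at _ _ _ q2).
Qed.

Lemma vhoro_atK (T : tree) q (o : T) : (2 <= q)%N -> homogeneous T q ->
  cancel (fun p => vhoro_at o p.1 p.2) (vchart o).
Proof. by move=> q2 hom [w n]; rewrite (vchart_at _ _ _ q2). Qed.

Lemma ehoro_atK (T : tree) q (eo : edge T) : (2 <= q)%N -> homogeneous T q ->
  cancel (fun p => ehoro_at eo p.1 p.2) (echart eo).
Proof. by move=> q2 hom [w n]; rewrite (echart_at _ _ _ q2). Qed.

Lemma vshift_at (T : tree) q (o : T) (eo : edge T) (c : tree_end T -> int) w n :
  (2 <= q)%N -> homogeneous T q ->
  vshift o eo c (vhoro_at o w n) = ehoro_at eo w (n + c w)%R.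
Proof. by move=> q2 hom; rewrite /vshift (vchart_at _ _ _ q2). Qed.

Lemma eshift_at (T : tree) q (o : T) (eo : edge T) (c : tree_end T -> int) w n :
  (2 <= q)%N -> homogeneous T q ->
  eshift o eo c (ehoro_at eo w n) = vhoro_at o w (n + c w)%R.
Proof. by move=> q2 hom; rewrite /eshift (echart_at _ _ _ q2). Qed.

Lemma vact_at (T : tree) q (o : T) k w (n : int) :
  (2 <= q)%N -> homogeneous T q ->
  @zact (vbundle o) k (vhoro_at o w n) = vhoro_at o w (n + k)%R.
Proof.
by move=> q2 hom; rewrite -[LHS]/(vhoro_at o _ _) (vchart_at _ _ _ q2).
Qed.

Lemma eact_at (T : tree) q (eo : edge T) k w (n : int) :
  (2 <= q)%N -> homogeneous T q ->
  @zact (ebundle eo) k (ehoro_at eo w n) = ehoro_at eo w (n + k)%R.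
Proof.
by move=> q2 hom; rewrite -[LHS]/(ehoro_at eo _ _) (echart_at _ _ _ q2).
Qed.

Lemma vshift_iso (T : tree) q (o : T) (eo : edge T) (c : tree_end T -> int) :
  (2 <= q)%N -> homogeneous T q -> locally_constant c ->
  bundle_iso (vbundle o) (ebundle eo) (vshift o eo c).
Proof.
move=> q2 hom lc; split.
- exact: (shift_homeomorphism (vchartK o q2 hom) (vhoro_atK o q2 hom)
    (echartK eo q2 hom) (ehoro_atK eo q2 hom) lc).
- move=> k h; have [n ->] := vhoro_atP o h.
  rewrite (vact_at _ _ _ _ q2) // !(vshift_at _ _ _ _ _ q2) //.
  by rewrite (eact_at _ _ _ _ q2) // addrAC.
- by exists id; [exact: homeomorphism_id|].
Qed.

Lemma eshift_iso (T : tree) q (o : T) (eo : edge T) (c : tree_end T -> int) :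
  (2 <= q)%N -> homogeneous T q -> locally_constant c ->
  bundle_iso (ebundle eo) (vbundle o) (eshift o eo c).
Proof.
move=> q2 hom lc; split.
- exact: (shift_homeomorphism (echartK eo q2 hom) (ehoro_atK eo q2 hom)
    (vchartK o q2 hom) (vhoro_atK o q2 hom) lc).
- move=> k h; have [n ->] := ehoro_atP eo h.
  rewrite (eact_at _ _ _ _ q2) // !(eshift_at _ _ _ _ _ q2) //.
  by rewrite (vact_at _ _ _ _ q2) // addrAC.
- by exists id; [exact: homeomorphism_id|].
Qed.

(** * Special sections in the charts *)

(** In the chart of [o] the special section is the graph of the index of [v] over [o]. *)
Lemma vsectionP (T : tree) (o v : T) (h : vhorosphere T) :
  vsection v h <-> h = vhoro_at o (vtangency h) (vindex v o (vtangency h)).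
Proof.
split=> [|->]; last by rewrite /vsection /= /vlevel /=.
by have [n ->] := vhoro_atP o h; rewrite /vsection /= => vn; rewrite -[n]vn.
Qed.

Lemma esectionP (T : tree) (eo e : edge T) (h : ehorosphere T) :
  esection e h <-> h = ehoro_at eo (etangency h) (eindex e eo (etangency h)).
Proof.
split=> [|->]; last by rewrite /esection /= /elevel /=.
by have [n ->] := ehoro_atP eo h; rewrite /esection /= => en; rewrite -[n]en.
Qed.

Lemma vshift_section (T : tree) q (o v : T) (eo e : edge T) :
  (2 <= q)%N -> homogeneous T q ->
  vshift o eo (fun w => eindex e eo w - vindex v o w)%R @` vsection v =
  esection e.
Proof.
move=> q2 hom; apply/seteqP; split=> [_ [h /(vsectionP o) -> <-]|h].
  rewrite (vshift_at _ _ _ _ _ q2) //; apply/(esectionP eo) => /=.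
  by rewrite addrC subrK.
move=> /(esectionP eo) ->; set w := etangency h.
exists (vhoro_at o w (vindex v o w)); first exact/(vsectionP o).
by rewrite (vshift_at _ _ _ _ _ q2) // addrC subrK.
Qed.

Lemma eshift_section (T : tree) q (o v : T) (eo e : edge T) :
  (2 <= q)%N -> homogeneous T q ->
  eshift o eo (fun w => vindex v o w - eindex e eo w)%R @` esection e =
  vsection v.
Proof.
move=> q2 hom; apply/seteqP; split=> [_ [h /(esectionP eo) -> <-]|h].
  rewrite (eshift_at _ _ _ _ _ q2) //; apply/(vsectionP o) => /=.
  by rewrite addrC subrK.
move=> /(vsectionP o) ->; set w := vtangency h.
exists (ehoro_at eo w (eindex e eo w)); first exact/(esectionP eo).
by rewrite (eshift_at _ _ _ _ _ q2) // addrC subrK.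
Qed.

(** * The canonical correspondence *)

(* The edge [v, v_+] has near endpoint v_+, of index one more than v. *)
Definition xi (T : tree) (o : T) (eo : edge T) :
    vhorosphere T -> ehorosphere T :=
  vshift o eo (fun w => 1 + vindex o (head eo w) w)%R.

(** By the cocycle identity, an edge lies on the image level exactly when its far endpoint lies on
    level [n] over [o]. *)
Lemma xi_canonical (T : tree) q (o : T) (eo : edge T) :
  (2 <= q)%N -> homogeneous T q -> canonical_correspondence (xi o eo).
Proof.
move=> q2 hom h; have [n ->] := vhoro_atP o h; set w := vtangency h.
rewrite /xi (vshift_at _ _ _ _ _ q2) //; split=> //=.
apply/seteqP; split=> e /=; rewrite /elevel /vlevel /= eindexE.
  have [t [th eE hh]] := head_tail e w => ne.
  exists t, (head e w); split=> //; last by apply/closerP; rewrite hh.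
  have := vindexD w (head e w) t (head eo w).
  by have := vindexD w t o (head eo w); lia.
move=> [v [u [vn vu /closerP uv eE]]].
have uv1 : vindex u v w = 1%R.
  have uv' : adj u v by rewrite adj_sym.
  by have [//|h1] := vindex_adj w uv'; move: uv; rewrite h1.
rewrite (headE vu eE uv1) (vindexD w u v) (vindexD w v o); lia.
Qed.

Lemma canonical_aut (T : tree) (Xi : vhorosphere T -> ehorosphere T)
    (g : automorphism T) (h : vhorosphere T) :
  canonical_correspondence Xi -> Xi (aut_vhoro g h) = aut_ehoro g (Xi h).
Proof.
move=> XiP; have [t1 c1] := XiP (aut_vhoro g h); have [t2 c2] := XiP h.
apply: ehorosphere_eq; first by rewrite t1 /= t2.
rewrite c1 /= c2; have [k gk kg] := aut_bij g.
apply/seteqP; split=> [e /= [_ [u [[v hv <-] vu uv eE]]]|_ /= [e +] <-].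
  have uE : u = g (k u) by rewrite kg.
  rewrite uE in vu uv eE; rewrite aut_adj in vu; move/aut_closer in uv.
  exists (Edge (ex_intro _ v (ex_intro _ (k u) (conj vu erefl)))).
    by exists v, (k u).
  by apply: edge_eq; rewrite /= eE image_setU !image_set1.
move=> [v [u [hv vu uv eE]]]; exists (g v), (g u); split.
- by exists v.
- by rewrite aut_adj.
- exact/aut_closer.
- by rewrite /= eE image_setU !image_set1.
Qed.

(** Otherwise the near endpoint of [e] would have index 1 over [v] for every end. Two ends that
    traverse [e] in opposite directions then give the endpoint [b] the indices 1 and 0, against
    parity. *)
Lemma canonical_section (T : tree) q (o : T)
    (Xi : vhorosphere T -> ehorosphere T) (v : T) (e : edge T) :
  (2 <= q)%N -> homogeneous T q -> canonical_correspondence Xi ->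
  Xi @` vsection v <> esection e.
Proof.
move=> q2 hom XiP XiE.
have head_index w : vindex (head e w) v w = 1%R.
  have : esection e (Xi (vhoro_at o w (vindex v o w))).
    by rewrite -XiE; exists (vhoro_at o w (vindex v o w)).
  rewrite /esection /=; have [_ ->] := XiP (vhoro_at o w (vindex v o w)).
  move=> /= [t [u [tv tu /closerP ut eE]]].
  have ut1 : vindex u t w = 1%R.
    have ut' : adj u t by rewrite adj_sym.
    by have [//|h1] := vindex_adj w ut'; move: ut; rewrite h1.
  rewrite (headE tu eE ut1) (vindexD w u t) ut1.
  move: tv; rewrite /vlevel /= (vindexD w t v o); lia.
have [a [b [ab eE]]] := endpointsP e; have ba : adj b a by rewrite adj_sym.
have [w1 /(_ a)] := forward_end q2 hom ab.
rewrite distxx (dist_adj ab) => /(_ erefl) h1.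
have [w2 /(_ b)] := forward_end q2 hom ba.
rewrite distxx (dist_adj ba) => /(_ erefl) h2.
have := head_index w1; rewrite (headE ab eE h1) => i1.
have eE' : endpoints e = [set b; a] by rewrite eE setUC.
have := head_index w2; rewrite (headE ba eE' h2) => i2.
have [k] := vindex_parity v b w1 w2.
by rewrite i1 (vindexD w2 b a v) i2 vindexN h2; lia.
Qed.

(** * Pairs of special sections *)

(** For an end beyond [v] as seen from [v0] the index is the distance. *)
Lemma vindex_neq0 (T : tree) q (v0 v : T) : (2 <= q)%N -> homogeneous T q ->
  v0 <> v -> exists w, vindex v v0 w <> 0%R.
Proof.
move=> q2 hom vv; have [u vu du] := closer_neighbour vv.
have uv : adj u v by rewrite adj_sym.
have [w /(_ v0 du) hw] := forward_end q2 hom uv.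
by exists w; rewrite hw du.
Qed.

(* The two ends run through e0 in the same direction and separate at an
   endpoint of e, one of them traversing e and the other one leaving it. *)
Lemma separating_ends (T : tree) q (e0 e : edge T) : (2 <= q)%N ->
  homogeneous T q -> e <> e0 ->
  exists w1 w2 a c d, [/\ head e0 w1 = a, head e0 w2 = a, head e w1 = d,
    head e w2 = c & adj c d].
Proof.
move=> q2 hom.
(* Normal position: [a] is the endpoint of [e0] nearer to [e], and [c] the endpoint of [e] nearer to
   [e0]. *)
suff main (a b c d : T) : endpoints e0 = [set a; b] -> adj a b ->
    endpoints e = [set c; d] -> adj c d -> dist b c = (dist a c).+1 ->
    dist a d = (dist a c).+1 -> dist b d = (dist b c).+1 ->
    exists w1 w2 a c d, [/\ head e0 w1 = a, head e0 w2 = a, head e w1 = d,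
      head e w2 = c & adj c d].
  move=> ne.
  have [a [b [ab e0E]]] := endpointsP e0; have [c [d [cd eE]]] := endpointsP e.
  have ba : adj b a by rewrite adj_sym.
  have dc : adj d c by rewrite adj_sym.
  have e0E' : endpoints e0 = [set b; a] by rewrite e0E setUC.
  have eE' : endpoints e = [set d; c] by rewrite eE setUC.
  have sq x y z t : endpoints e0 = [set x; y] -> endpoints e = [set z; t] ->
      ~ (x = z /\ y = t).
    by move=> E0 E [xz yt]; apply: ne; apply: edge_eq; rewrite E0 E xz yt.
  have := dist_adjP a cd; have := dist_adjP b cd.
  have := dist_adjP c ab; have := dist_adjP d ab.
  rewrite (dist_sym c a) (dist_sym c b) (dist_sym d a) (dist_sym d b).
  (* Of the patterns that survive, four are the normal position up to renaming; in the other two the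
     square closes up, forcing [e = e0]. *)
  move=> [D|D] [C|C] [B|B] [A|A]; try lia.
  - exact: (main a b c d).
  - exact: (main a b d c).
  - case: (sq _ _ _ _ e0E eE'); apply: square_degenerate => //; lia.
  - case: (sq _ _ _ _ e0E eE); apply: square_degenerate => //; lia.
  - exact: (main b a c d).
  - exact: (main b a d c).
move=> e0E ab eE cd bc ad bd.
have ba : adj b a by rewrite adj_sym.
have e0E' : endpoints e0 = [set b; a] by rewrite e0E setUC.
have nbc : b <> c by move=> bE; move: bc; rewrite bE distxx.
have [p cp bp] := closer_neighbour nbc.
(* From [c] there is a way on that neither goes back towards [b] nor runs through [e]; it leads to
   the second end. *)
have [y [cy yp yd]] := third_neighbour c p d q2 hom.
have by_ : dist b y = (dist b c).+1.
  have [//|h] := dist_adjP b cy.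
  by case: yp; exact: (closer_neighbour_uniq cy cp h bp).
have ay : dist a y = (dist a c).+1.
  have := dist_adjP a cy; have := dist_adj_le y ab.
  by rewrite !(dist_sym y); lia.
have [w1 H1] := forward_end q2 hom cd; have [w2 H2] := forward_end q2 hom cy.
have h1 : vindex d c w1 = 1%R by rewrite H1 ?(dist_adj cd) ?distxx.
have h2 : vindex y c w2 = 1%R by rewrite H2 ?(dist_adj cy) ?distxx.
have dc : adj d c by rewrite adj_sym.
have h2' : vindex c d w2 = 1%R.
  rewrite vindexN; have [h|->//] := vindex_adj w2 dc.
  by case: yd; exact: (succ_uniq cy cd h2 h).
(* By the cocycle identity the index of [a] over [b] is [dist b d - dist a d], which is 1; likewise
   with [y] for [w2]. *)
have a1 : vindex a b w1 = 1%R.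
  by have := vindexD w1 d a b; rewrite !H1 //; lia.
have a2 : vindex a b w2 = 1%R.
  by have := vindexD w2 y a b; rewrite !H2 //; lia.
exists w1, w2, a, c, d; split=> //.
- exact: (headE ba e0E' a1).
- exact: (headE ba e0E' a2).
- exact: (headE cd eE h1).
- by apply: (headE dc _ h2'); rewrite eE setUC.
Qed.

(** The near endpoints of [e] for the two ends are adjacent, so their indices over the common near
    endpoint of [e0] have opposite parities; by [vindex_parity] it does not matter that the ends
    differ. *)
Lemma eindex_parity (T : tree) q (e0 e : edge T) : (2 <= q)%N ->
  homogeneous T q -> e <> e0 ->
  exists w1 w2, ~ exists k : int, (eindex e e0 w1 - eindex e e0 w2 = k + k)%R.
Proof.
move=> q2 hom ne.
have [w1 [w2 [a [c [d [a1 a2 d1 c2 cd]]]]]] := separating_ends q2 hom ne.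
exists w1, w2 => -[k]; rewrite !eindexE a1 a2 d1 c2.
have [k' hk'] := vindex_parity a d w1 w2.
have := vindexD w2 d c a; have dc : adj d c by rewrite adj_sym.
by have [->|->] := vindex_adj w2 dc; lia.
Qed.

(** The action of [vindex v v0 w] carries the point of the section of [v0] over [w] to that of the
    section of [v]. As [alpha] is equivariant and covers [phi], the same integer separates the
    images. *)
Lemma iso_sections_index (T : tree) q (o v0 v : T) (eo e0 e : edge T)
    (alpha : vhorosphere T -> ehorosphere T) : (2 <= q)%N -> homogeneous T q ->
  bundle_iso (vbundle o) (ebundle eo) alpha ->
  alpha @` vsection v0 = esection e0 -> alpha @` vsection v = esection e ->
  exists2 phi : tree_end T -> tree_end T,
    forall w', exists w, phi w = w' &
    forall w, eindex e e0 (phi w) = vindex v v0 w.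
Proof.
move=> q2 hom [_ equi [phi [_ [psi [_ phiK _]]] cov]] s0 s.
exists phi => [w'|w]; first by exists (psi w').
have img u f : alpha @` vsection u = esection f ->
    alpha (vhoro_at o w (vindex u o w)) = ehoro_at eo (phi w) (eindex f eo (phi w)).
  move=> uf; have tE : etangency (alpha (vhoro_at o w (vindex u o w))) = phi w.
    exact: (cov (vhoro_at o w (vindex u o w))).
  rewrite -[in RHS]tE; apply/esectionP; rewrite -uf.
  by exists (vhoro_at o w (vindex u o w)).
have := equi (vindex v v0 w) (vhoro_at o w (vindex v0 o w)).
rewrite (vact_at _ _ _ _ q2) // addrC -vindexD (img v e) // (img v0 e0) //.
rewrite (eact_at _ _ _ _ q2) // => /(congr1 (echart eo)).
rewrite !(echart_at _ _ _ q2) // => -[] eE.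
by have := eindexD (phi w) e e0 eo; rewrite eE; lia.
Qed.

Theorem proposition1p3p27 (q : nat) (T : tree) (q_ge2 : (2 <= q)%N)
    (T_hom : homogeneous T q) (o : T) (eo : edge T) :
  [/\ exists Xi : vhorosphere T -> ehorosphere T,
        [/\ canonical_correspondence Xi,
            bundle_iso (vbundle o) (ebundle eo) Xi,
            forall (g : automorphism T) (h : vhorosphere T),
              Xi (aut_vhoro g h) = aut_ehoro g (Xi h) &
            forall (v : T) (e : edge T), Xi @` vsection v <> esection e],
      ~ exists (alpha : vhorosphere T -> ehorosphere T)
               (v0 v : T) (e0 e : edge T),
          [/\ bundle_iso (vbundle o) (ebundle eo) alpha,
              v0 <> v,
              alpha @` vsection v0 = esection e0 &
              alpha @` vsection v = esection e] &
      forall (v : T) (e : edge T),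
        (exists2 alpha : vhorosphere T -> ehorosphere T,
           bundle_iso (vbundle o) (ebundle eo) alpha &
           alpha @` vsection v = esection e) /\
        (exists2 beta : ehorosphere T -> vhorosphere T,
           bundle_iso (ebundle eo) (vbundle o) beta &
           beta @` esection e = vsection v)].
Proof.
split.
- have Xi_can := xi_canonical o eo q_ge2 T_hom.
  exists (xi o eo); split=> //.
  + apply: (vshift_iso _ _ q_ge2) => // w.
    by apply: filterS (vindex_head_locally_constant eo o w) => w' ->.
  + by move=> g h; exact: canonical_aut.
  + by move=> v e; exact: (canonical_section o q_ge2).
- move=> [alpha [v0 [v [e0 [e [iso vv s0 s]]]]]].
  have [phi phi_surj idx] := iso_sections_index q_ge2 T_hom iso s0 s.
  have [ee|ne] := pselect (e = e0); last first.
    have [w1 [w2]] := eindex_parity q_ge2 T_hom ne; apply.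
    have [w1' <-] := phi_surj w1; have [w2' <-] := phi_surj w2.
    by rewrite !idx; exact: vindex_parity.
  have [w] := vindex_neq0 q_ge2 T_hom vv; apply.
  by rewrite -idx ee eindexxx.
- move=> v e; split.
  + exists (vshift o eo (fun w => eindex e eo w - vindex v o w)%R).
      apply: (vshift_iso _ _ q_ge2) => // w.
      by apply: filterS2 (eindex_locally_constant e eo w)
        (vindex_locally_constant v o w) => w' -> ->.
    exact: (vshift_section _ _ _ _ q_ge2).
  + exists (eshift o eo (fun w => vindex v o w - eindex e eo w)%R).
      apply: (eshift_iso _ _ q_ge2) => // w.
      by apply: filterS2 (eindex_locally_constant e eo w)
        (vindex_locally_constant v o w) => w' -> ->.
    exact: (eshift_section _ _ _ _ q_ge2).
Qed.
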